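(* Let $d$ be a positive integer, and let $\varphi:\mathbb T^d\to\mathbb T^d$ be an affine self-mapping of the torus, $\varphi(x)=Ax+b$, where $A$ is an integer $d\times d$ matrix and $b\in\mathbb T^d$. Then the semicascade $(\mathbb T^d, G_\varphi^+)$ generated by $\varphi$ is tame if and only if there exist nonnegative integers $p\neq q$ such that $A^p=A^q$.
   Context: $\mathbb T^d=\mathbb R^d/(2\pi\mathbb Z)^d$ is the $d$-dimensional torus with its usual (compact, metrizable) topology. An affine self-mapping of $\mathbb T^d$ is a map of the form $\varphi(x)=Ax+b$ with $A$ an integer $d\times d$ matrix (called the matrix of $\varphi$) and $b\in\mathbb T^d$. $A^0=I$ is the identity matrix. For a continuous map $\varphi:X\to X$, the semicascade generated by $\varphi$ is the system $(X,G_\varphi^+)$, where $G_\varphi^+=\{\varphi^n : n=0,1,2,\ldots\}$ is the semigroup of iterations of $\varphi$ ($\varphi^0$ is the identity mapping, $\varphi^{n+1}=\varphi\circ\varphi^n$). Tameness (Köhler). A sequence $f_n$, $n=1,2,\ldots$, of real-valued functions on a set $X$ is independent if there exist $a,b\in\mathbb R$, $a<b$, such that $\bigcap_{n\in P}\{x: f_n(x)<a\}\cap\bigcap_{n\in Q}\{x: f_n(x)>b\}\neq\varnothing$ for all finite disjoint sets $P,Q$ of indices. Let $X$ be a compact Hausdorff space and $G$ a group or semigroup of continuous mappings of $X$ into itself. The system $(X,G)$ is tame if for every real-valued continuous function $f$ on $X$ the family $\{f_g: g\in G\}$, where $f_g(x)=f(gx)$, does not contain an independent sequence. When $X$ is a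 compact metric space (as here), the paper uses the following equivalent definition: $(X,G)$ is tame if each sequence $g_n\in G$, $n=1,2,\ldots$, has a subsequence $g_{n_k}$, $k=1,2,\ldots$, that converges pointwise, i.e., such that for every $x\in X$ the sequence $g_{n_1}x,g_{n_2}x,\ldots$ converges in $X$. *)

(* Defs.v *)
From HB Require Import structures.
From mathcomp Require Import all_boot all_order all_algebra.
From mathcomp Require Import generic_quotient ring_quotient.
From mathcomp Require Import all_classical all_reals all_analysis.
Import Order.TTheory GRing.Theory Num.Theory.
Import numFieldNormedType.Exports.

Set Implicit Arguments.
Unset Strict Implicit.
Unset Printing Implicit Defensive.

Local Open Scope classical_set_scope.
Local Open Scope ring_scope.
Local Open Scope quotient_scope.

(* The lattice (2 pi Z)^d, as a subgroup of R^d (column vectors). *)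
Definition period_lattice (R : realType) (d : nat) : {pred 'cV[R]_d} :=
  fun x => `[< exists z : 'cV[int]_d, x = (pi *+ 2) *: map_mx intr z >].
Arguments period_lattice : clear implicits.

Lemma period_latticeP (R : realType) (d : nat) (x : 'cV[R]_d) :
  reflect (exists z : 'cV[int]_d, x = (pi *+ 2) *: map_mx intr z)
          (x \in period_lattice R d).
Proof. exact: asboolP. Qed.

Lemma period_lattice_zmod (R : realType) (d : nat) :
  zmod_closed (period_lattice R d).
Proof.
split=> [|_ _ /period_latticeP[z ->] /period_latticeP[w ->]].
  by apply/period_latticeP; exists 0; rewrite map_mx0 scaler0.
by apply/period_latticeP; exists (z - w); rewrite map_mxB scalerBr.
Qed.

HB.instance Definition _ (R : realType) (d : nat) :=
  GRing.isZmodClosed.Build 'cV[R]_d (period_lattice R d)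
    (@period_lattice_zmod R d).

(* The torus R^d / (2 pi Z)^d: the quotient group with the quotient topology.
   The alias quotient_topology hides the group structure of the quotient, which
   is therefore copied explicitly. *)
Definition torus (R : realType) (d : nat) : Type :=
  quotient_topology (Quotient.quot (period_lattice R d)).

HB.instance Definition _ (R : realType) (d : nat) :=
  Topological.copy (torus R d)
    (quotient_topology (Quotient.quot (period_lattice R d))).
HB.instance Definition _ (R : realType) (d : nat) :=
  Quotient.copy (torus R d) (Quotient.quot (period_lattice R d)).
HB.instance Definition _ (R : realType) (d : nat) :=
  GRing.Zmodule.copy (torus R d) (Quotient.quot (period_lattice R d)).

Lemma eq_torus (R : realType) (d : nat) (x y : 'cV[R]_d) :
  \pi_(torus R d) x = \pi_(torus R d) y <-> x - y \in period_lattice R d.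
Proof.
have := Quotient.idealrBE (period_lattice R d) x y.
by move=> ->; split => [h|/eqP]; [apply/eqP|].
Qed.

Lemma pi_torusD (R : realType) (d : nat) (x y : 'cV[R]_d) :
  \pi_(torus R d) (x + y) = \pi_(torus R d) x + \pi_(torus R d) y.
Proof. exact: (Quotient.pi_add (period_lattice R d) x y). Qed.

(* x |-> A x on the torus; the choice of representative is immaterial because
   A has integer entries, see torus_mul_pi. *)
Definition torus_mul (R : realType) (d : nat) (A : 'M[int]_d) (x : torus R d) :
    torus R d :=
  \pi_(torus R d) (map_mx intr A *m repr x).

Lemma torus_mul_pi (R : realType) (d : nat) (A : 'M[int]_d) (x : 'cV[R]_d) :
  torus_mul A (\pi_(torus R d) x) = \pi_(torus R d) (map_mx intr A *m x).
Proof.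
apply/eq_torus; rewrite -mulmxBr.
have /eq_torus/period_latticeP[z ->] :
    \pi_(torus R d) (repr (\pi_(torus R d) x)) = \pi_(torus R d) x.
  exact: reprK.
by apply/period_latticeP; exists (A *m z); rewrite -scalemxAr map_mxM.
Qed.

Definition torus_affine (R : realType) (d : nat) (A : 'M[int]_d)
    (b : torus R d) (x : torus R d) : torus R d :=
  torus_mul A x + b.

Definition semicascade (X : Type) (phi : X -> X) : set (X -> X) :=
  [set g | exists n : nat, g = iter n phi].

(* Tameness of (X, G), for X a compact metrizable space: the sequential
   definition, equivalent for such X to the absence of independent sequences
   among the functions f \o g, with f real-valued continuous and g in G. *)
Definition tame (X : topologicalType) (G : set (X -> X)) : Prop :=
  forall g : nat -> X -> X, (forall n, G (g n)) ->
  exists k : nat -> nat,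
    {homo k : m n / (m < n)%N} /\
    forall x : X, exists l : X, (fun n => g (k n) x) @ \oo --> l.

(* Main.v *)
(** Write [phi^n x = A^n x + c_n] with representatives [c_n] in [[0, 2 pi]^d].

    If the powers of [A] repeat, they take finitely many values, so any
    sequence of iterates has a subsequence along which the matrix is constant
    and [c_n] converges; that subsequence converges pointwise.

    Conversely, let [phi^(k n)] converge pointwise. For the points [x = t e_j],
    the [i]-th coordinate of [phi^(k (n+1)) x - phi^(k n) x] has the form
    [w_n t + g_n], where the integer [w_n] is the [(i, j)] entry of
    [A^(k (n+1)) - A^(k n)], and it tends to 0 modulo [2 pi]. Hence
    [cos (w_n t + g_n)] tends to 1 for every [t], and by dominated convergence
    its integral over a period tends to [2 pi]. That integral vanishes when
    [w_n <> 0], so [w_n = 0] eventually, and two powers of [A] coincide. *)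
Require Import Defs.
From mathcomp Require Import all_boot all_order all_algebra.
From mathcomp Require Import all_classical all_reals all_analysis.
From mathcomp Require Import measurable_realfun ring lra.
Import Order.TTheory GRing.Theory Num.Theory.
Import numFieldNormedType.Exports.

Local Open Scope classical_set_scope.
Local Open Scope ring_scope.
Local Open Scope quotient_scope.

Lemma periodicz (U V : zmodType) (f : U -> V) (T : U) : periodic f T ->
  forall (z : int) u, f (u + T *~ z) = f u.
Proof.
move=> fT [n|n] u; first exact: periodicn.
by rewrite NegzE mulrNz -(periodicn fT n.+1 (u - _)) subrK.
Qed.

Lemma periodic_repr_torus (R : realType) (d : nat) (f : R -> R) (i : 'I_d)
    (x : 'cV[R]_d) : periodic f (pi *+ 2) ->
  f (repr (\pi_(torus R d) x) i 0) = f (x i 0).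
Proof.
move=> fT; set y := repr _.
have /eq_torus/period_latticeP[z /(canRL (subrK _)) ->] :
  \pi_(torus R d) y = \pi_(torus R d) x by exact: reprK.
by rewrite !mxE addrC mulrzr periodicz.
Qed.

(** The map [repr] need not be continuous, but a periodic [f] does not see the choice of
    representative, so the map descends from a continuous one on R^d. *)
Lemma periodic_repr_torus_continuous (R : realType) (d : nat) (f : R -> R)
    (i : 'I_d) : continuous f -> periodic f (pi *+ 2) ->
  continuous (fun y : torus R d => f (repr y i 0)).
Proof.
move=> cf fT.
apply: (@repr_comp_continuous 'cV[R]_d _ R (fun x => f (x i 0))).
  by move=> x; apply: continuous_comp (cf _); exact: coord_continuous.
by move=> x y /eqP xy; apply/eqP; rewrite -periodic_repr_torus// [X in repr X]xy
  periodic_repr_torus.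
Qed.

Lemma iter_torus_affine (R : realType) (d : nat) (A : 'M[int]_d)
    (b : torus R d) (n : nat) : exists c : 'cV[R]_d,
  (forall i, 0 <= c i 0 <= pi *+ 2) /\
  forall x, iter n (torus_affine A b) (\pi_(torus R d) x) =
            \pi_(torus R d) (map_mx intr (A ^+ n) *m x + c).
Proof.
have [c cE] : exists c : 'cV[R]_d, forall x,
    iter n (torus_affine A b) (\pi_(torus R d) x) =
    \pi_(torus R d) (map_mx intr (A ^+ n) *m x + c).
  elim: n => [|n [c cE]].
    by exists 0 => x; rewrite expr0 map_mx1 mul1mx addr0.
  exists (map_mx intr A *m c + repr b) => x.
  rewrite iterS cE /torus_affine torus_mul_pi mulmxDr exprS.
  rewrite -[(A * _)%R]/(A *m _) map_mxM mulmxA addrA [RHS]pi_torusD.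
  by congr (_ + _); rewrite reprK.
have p0 : 0 < pi *+ 2 :> R by rewrite mulrn_wgt0 // pi_gt0.
(* Removing whole periods from each coordinate keeps the class on the torus. *)
pose z : 'cV[int]_d := \col_i Num.floor (c i 0 / (pi *+ 2)).
exists (c - (pi *+ 2) *: map_mx intr z); split=> [i|x].
  rewrite !mxE; have := floor_itv (c i 0 / (pi *+ 2)).
  rewrite intrD ler_pdivlMr // ltr_pdivrMr //.
  move=> /andP[]; set f := (_%:~R); set t := pi *+ 2; lra.
rewrite cE; apply/eq_torus/period_latticeP; exists z.
by rewrite [X in _ - X]addrA subKr.
Qed.

Lemma fmap_ultra (S T : Type) (f : S -> T) (U : set_system S) :
  UltraFilter U -> UltraFilter (f @ U).
Proof.
move=> UU; split=> [|G GG UG]; first exact: fmap_proper_filter.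
apply/seteqP; split=> // B GB.
have [//|UnB] := in_ultra_setVsetC (f @^-1` B) UU.
have GnB : G (~` B) by apply: UG.
by have [x []] := filter_ex (filterI GB GnB).
Qed.

(** Along an ultrafilter, compactness of [0, a] gives a limit in each coordinate at once, with no
    nested extraction of subsequences. *)
Lemma bounded_ultra_cvg (R : realType) (d : nat) (T : Type)
    (U : set_system T) (UU : UltraFilter U) (c : T -> 'cV[R]_d) (a : R) :
  (forall n i, 0 <= c n i 0 <= a) -> exists l : 'cV[R]_d, c @ U --> l.
Proof.
move=> ca.
have /choice[l lP] (i : 'I_d) : exists t : R, c n i 0 @[n --> U] --> t.
  have := @segment_compact R 0 a; rewrite compact_ultra.
  move=> /(_ ((fun n => c n i 0) @ U) (@fmap_ultra _ _ _ _ UU) _) [|t [_]].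
    by apply: (@filterE _ U) => n /=; rewrite in_itv /=; exact: ca.
  by exists t.
exists (\col_i l i) => B [P P1 PB].
suff : \forall n \near U, forall i, P i 0 (c n i 0).
  by apply: filterS => n cP; apply: PB => i j; rewrite ord1.
by apply: filter_forall => i; apply: lP; have := P1 i 0; rewrite mxE.
Qed.

Lemma continuous_cos_affine (R : realType) (w c : R) :
  continuous (fun t : R => cos (w * t + c)).
Proof.
move=> t; apply: (@continuous_comp _ _ _ (fun t => w * t + c) cos).
  by apply: cvgD; [apply: cvgMr; exact: cvg_id|exact: cvg_cst].
exact: continuous_cos.
Qed.

Lemma integral_cos_affine (R : realType) (w : int) (c : R) : w != 0 ->
  (\int[@lebesgue_measure R]_(t in `[0%R, (pi *+ 2)%R])
    (cos (w%:~R * t + c))%:E = 0)%E.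
Proof.
move=> w0; have w0R : w%:~R != 0 :> R by rewrite intr_eq0.
pose F (t : R) := w%:~R^-1 * sin (w%:~R * t + c).
have dF (t : R) : is_derive t 1 F (cos (w%:~R * t + c)).
  have dg : is_derive t 1 (fun t => w%:~R * t + c) w%:~R.
    by apply: is_derive_eq; rewrite addr0 scaler1.
  rewrite /F; apply: is_derive_eq.
  by rewrite [LHS]mulrCA mulVf ?mulr1.
(* As [w] is an integer, the phases at the two endpoints differ by whole periods. *)
have F2pi : F (pi *+ 2) = F 0.
  rewrite /F mulr0 add0r addrC mulrzl periodicz //; exact: sinD2pi.
rewrite (@continuous_FTC2 _ _ F) ?F2pi ?subee //.
- by rewrite mulrn_wgt0 // pi_gt0.
- exact/continuous_subspaceT/continuous_cos_affine.
- have cF t : F @ t --> F t.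
    by apply/differentiable_continuous/derivable1_diffP.
  split=> //; [exact: cvg_at_right_filter|exact: cvg_at_left_filter].
- by move=> t _; rewrite derive1E derive_val.
Qed.

Lemma cvg_cos_affine_eq0 (R : realType) (w : nat -> int) (c : nat -> R) :
  (forall t : R, cos ((w n)%:~R * t + c n) @[n --> \oo] --> (1 : R)) ->
  \forall n \near \oo, w n = 0.
Proof.
move=> wc; have p0 : 0 < pi *+ 2 :> R by rewrite mulrn_wgt0 // pi_gt0.
pose D := `[0 : R, pi *+ 2].
pose f n (t : R) := (cos ((w n)%:~R * t + c n))%:E.
have muD : lebesgue_measure [set` D] = (pi *+ 2)%:E.
  by rewrite lebesgue_measure_itv /= lte_fin p0 -EFinD subr0.
have mD : measurable [set` D] by exact: measurable_itv.
have [] :=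
  @dominated_convergence _ _ R lebesgue_measure _ mD f (cst 1%E) (cst 1%E).
- move=> n; apply/measurable_EFinP/measurable_funTS.
  apply: continuous_measurable_fun; exact: continuous_cos_affine.
- exact: measurable_cst.
- by apply: aeW => t _; apply/cvg_EFin; [exact: nearW|exact: wc].
- apply: (@continuous_compact_integrable R (cst 1)).
    exact: segment_compact.
  exact/continuous_subspaceT/cst_continuous.
- by apply: aeW => t n _; rewrite lee_fin cos_max.
rewrite integral_cst // mul1e => _ _ fD.
have {fD} /fine_cvgP[_ /cvgrPdist_lt] :
    (\int[lebesgue_measure]_(t in [set` D]) f n t)%E @[n --> \oo]
      --> (pi *+ 2)%:E by rewrite -muD; exact: fD.
(* The tolerance is 2 pi itself: an integral at distance less than 2 pi from 2 pi cannot vanish. *)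
move=> /(_ _ p0); apply: filterS => n /=; apply: contraPP => /eqP wn0.
by rewrite integral_cos_affine //= subr0 gtr0_norm // ltxx.
Qed.

(** Returns from a filter to sequences: each tail, [E] and each ball around [l] pulled back by [u]
    belong to the proper filter [F], so they have a common index. *)
Lemma cvg_subseq (R : archiRealFieldType) (T : pseudoMetricType R)
    (u : nat -> T) (l : T) (F : set_system nat) (E : set nat) :
  ProperFilter F -> \oo `<=` F -> u @ F --> l -> F E ->
  exists k : nat -> nat, [/\ {homo k : m n / (m < n)%N},
    forall n, E (k n) & u (k n) @[n --> \oo] --> l].
Proof.
move=> FF ooF ul FE.
have /choice[f fP] (nN : nat * nat) : exists m,
    [/\ (nN.2 < m)%N, E m & ball l nN.1.+1%:R^-1 (u m)].
  have Fm : F [set m | (nN.2 < m)%N] by apply: ooF; exact: nbhs_infty_gt.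
  have Fb : F [set m | ball l nN.1.+1%:R^-1 (u m)].
    by apply: ul; apply: nbhsx_ballx; rewrite invr_gt0.
  by have [m [[]]] := filter_ex (filterI (filterI Fm FE) Fb); exists m.
(* Each index exceeds the previous one; the bound 0 at the start is arbitrary. *)
pose k := fix k n := f (n, if n is n'.+1 then k n' else 0%N).
have kE n : k n = f (n, if n is n'.+1 then k n' else 0%N) by case: n.
exists k; split=> [|n|]; last 2 first.
- by rewrite kE; have [] := fP (n, if n is n'.+1 then k n' else 0%N).
- apply/cvg_ballP => e e0; near=> n.
  have : n.+1%:R^-1 < e.
    by near: n; exact: (near_infty_natSinv_lt (PosNum e0)).
  move=> /ltW /le_ball; apply; rewrite kE.
  by have [] := fP (n, if n is n'.+1 then k n' else 0%N).
apply: homo_ltn => [? ? ? |n]; first exact: ltn_trans.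
by rewrite [k n.+1]kE; have [] := fP (n.+1, k n).
Unshelve. all: by end_near. Qed.

(** An exponent at least [q] can be lowered by [q - p] without changing the power. *)
Lemma expr_eq_ltn (S : pzSemiRingType) (x : S) (p q : nat) : (p < q)%N ->
  x ^+ p = x ^+ q -> forall n, exists i : 'I_q, x ^+ n = x ^+ i.
Proof.
move=> pq xpq; elim/ltn_ind => n IHn.
have [nq|qn] := ltnP n q; first by exists (Ordinal nq).
have [|i xi] := IHn (p + (n - q))%N.
  by rewrite -[X in (_ < X)%N](subnKC qn) ltn_add2r.
by exists i; rewrite -xi -{1}(subnKC qn) !exprD xpq.
Qed.

Lemma tame_torus_affine (R : realType) (d : nat) (A : 'M[int]_d)
    (b : torus R d) (p q : nat) : (p < q)%N -> A ^+ p = A ^+ q ->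
  tame (semicascade (torus_affine A b)).
Proof.
move=> pq Apq g /choice[a ga].
have /choice[c] := iter_torus_affine R d A b => /all_and2[c2pi cE].
(* A single ultrafilter finer than [\oo] handles both the translations and the matrices. *)
have [U [UU ooU]] := ultraFilterLemma (@eventually_filter).
have [l cl] := bounded_ultra_cvg _ _ _ _ UU (c \o a) _ (fun n => c2pi (a n)).
have [i Ai] : exists i : 'I_q, \forall n \near U, A ^+ a n = A ^+ i.
  (* Otherwise [U] contains the complements of finitely many sets that cover all indices. *)
  apply: contrapT => /forallNP nA.
  have : \forall n \near U, forall i : 'I_q, A ^+ a n <> A ^+ i.
    by apply: filter_forall => i; have [/nA|] :=
      in_ultra_setVsetC [set n | A ^+ a n = A ^+ i] UU.
  move=> /filter_ex[n nAn]; have [i Ai] := expr_eq_ltn _ _ _ _ pq Apq (a n).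
  exact: nAn Ai.
have [k [k_mono kA kl]] := cvg_subseq _ _ _ _ _ _ _ ooU cl Ai.
exists k; split=> // x.
exists (\pi_(torus R d) (map_mx intr (A ^+ i) *m repr x + l)).
rewrite (_ : (fun n => _) =
    \pi_(torus R d) \o (fun n => map_mx intr (A ^+ i) *m repr x + c (a (k n)))).
  apply: (@continuous_cvg _ _ _ \oo _ _ \pi_(torus R d)).
    exact: pi_continuous.
  by apply: cvgD kl; exact: cvg_cst.
by apply/funext => n; rewrite /= ga -[x in LHS]reprK cE (kA n).
Qed.

Lemma tame_torus_affine_expr_eq (R : realType) (d : nat) (A : 'M[int]_d)
    (b : torus R d) : tame (semicascade (torus_affine A b)) ->
  exists p q : nat, (p < q)%N /\ A ^+ p = A ^+ q.
Proof.
have /choice[c] := iter_torus_affine R d A b => /all_and2[_ cE].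
move=> /(_ (fun n => iter n (torus_affine A b)))[|k [k_mono kcvg]].
  by move=> n; exists n.
have : \forall n \near \oo, forall i j,
    (A ^+ k n.+1) i j - (A ^+ k n) i j = 0.
  apply: filter_forall => i; apply: filter_forall => j.
  apply: (@cvg_cos_affine_eq0 R _ (fun n => c (k n.+1) i 0 - c (k n) i 0)) => t.
  have [l] := kcvg (\pi_(torus R d) (t *: delta_mx j 0)).
  rewrite (_ : (fun n => _) = \pi_(torus R d) \o
    (fun n => map_mx intr (A ^+ k n) *m (t *: delta_mx j 0) + c (k n)));
    last first.
    by apply/funext => n; rewrite cE.
  set y := (fun n => _ + c (k n)) => yl.
  have yE n : y n i 0 = ((A ^+ k n) i j)%:~R * t + c (k n) i 0.
    by rewrite /y -scalemxAr -colE !mxE mulrC.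
  (* Only the classes of [y n] converge, so coordinates are tested through periodic functions. *)
  have ycvg (f : R -> R) : continuous f -> periodic f (pi *+ 2) ->
      f (y n i 0) @[n --> \oo] --> f (repr l i 0).
    move=> cf fT.
    rewrite (_ : (fun n => _) =
      (fun z : torus R d => f (repr z i 0)) \o (\pi_(torus R d) \o y)).
      apply: continuous_cvg yl; exact: periodic_repr_torus_continuous.
    by apply/funext => n /=; rewrite periodic_repr_torus.
  have ccvg := ycvg cos (@continuous_cos R) (@cosD2pi R).
  have scvg := ycvg sin (@continuous_sin R) (@sinD2pi R).
  (* The cosine of a difference of consecutive terms expands into products whose limits add up to
     cos^2 + sin^2 = 1. *)
  rewrite (_ : (fun n => _) = (fun n => cos (y n.+1 i 0) * cos (y n i 0) +
                                        sin (y n.+1 i 0) * sin (y n i 0))).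
    rewrite -(cos2Dsin2 (repr l i 0)) !expr2.
    have cScvg : cos (y n.+1 i 0) @[n --> \oo] --> cos (repr l i 0).
      by rewrite (cvg_shiftS (fun n => cos (y n i 0))).
    have sScvg : sin (y n.+1 i 0) @[n --> \oo] --> sin (repr l i 0).
      by rewrite (cvg_shiftS (fun n => sin (y n i 0))).
    exact: cvgD (cvgM cScvg ccvg) (cvgM sScvg scvg).
  apply/funext => n; rewrite -cosB !yE intrB; congr cos; ring.
move=> /filter_ex[n An]; exists (k n), (k n.+1); split; first exact: k_mono.
by apply/matrixP => i j; apply/esym/eqP; rewrite -subr_eq0 An.
Qed.

Theorem theorem1 (R : realType) (d : nat) (hd : (0 < d)%N)
    (A : 'M[int]_d) (b : torus R d) :
  tame (semicascade (torus_affine A b)) <->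
  exists p q : nat, p <> q /\ A ^+ p = A ^+ q.
Proof.
split=> [/tame_torus_affine_expr_eq[p [q [pq Apq]]]|[p [q [/eqP]]]].
  by exists p, q; split=> // pqE; rewrite pqE ltnn in pq.
rewrite neq_ltn => /orP[pq Apq|qp /esym Aqp].
  exact: tame_torus_affine pq Apq.
exact: tame_torus_affine qp Aqp.
Qed.
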